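(* Let $S \subset \mathbb{P}^3$ be a surface of degree $4$ defined over $\mathbb{F}_4$, irreducible over $\mathbb{F}_4$, and containing no $\mathbb{F}_4$-line. Then $N_4(S) \leq 51$ (which is the value $(d-1)(q^{n-1}+1)+(d-2)(\theta_q(n-3)-1)$ for $n=3$, $d=q=4$).
   Context: $N_4(S)$ denotes the number of $\mathbb{F}_4$-rational points of $S$. An $\mathbb{F}_4$-line is a line in $\mathbb{P}^3$ defined over $\mathbb{F}_4$. $\theta_q(s)=\frac{q^{s+1}-1}{q-1}$. *)

(* Defs.v *)
From HB Require Import structures.
From mathcomp Require Import all_boot all_order all_algebra all_field.
Set Implicit Arguments. Unset Strict Implicit. Unset Printing Implicit Defensive.
Import Order.TTheory GRing.Theory.
Local Open Scope ring_scope.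

(* Polynomials in 4 variables x0,x1,x2,x3 over a ring R, as iterated
   univariate polynomials: the outermost variable is x3, innermost x0. *)
Definition mpoly4 (R : nzRingType) := {poly {poly {poly {poly R}}}}.

Definition coef4 (R : nzRingType) (p : mpoly4 R) (e0 e1 e2 e3 : nat) : R :=
  (((p`_e3)`_e2)`_e1)`_e0.

Definition homogeneous (R : nzRingType) (d : nat) (p : mpoly4 R) : Prop :=
  forall e0 e1 e2 e3 : nat, coef4 p e0 e1 e2 e3 != 0 -> (e0 + e1 + e2 + e3)%N = d.

Definition irreducible4 (F : fieldType) (p : mpoly4 F) : Prop :=
  p != 0 /\ ~~ (p \is a GRing.unit) /\
  forall a b : mpoly4 F, p = a * b -> a \is a GRing.unit \/ b \is a GRing.unit.

Definition ev4 (F R : nzRingType) (f : F -> R) (p : mpoly4 F) (x : 'rV[R]_4) : R :=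
  let q := map_poly (map_poly (map_poly (map_poly f))) p in
  (((q.[(x 0 3%:R)%:P%:P%:P]).[(x 0 2%:R)%:P%:P]).[(x 0 1%:R)%:P]).[x 0 0].

(* normalized representative of a point of P^3(F): first nonzero coordinate is 1 *)
Definition normalized (F : fieldType) (v : 'rV[F]_4) : bool :=
  [exists i : 'I_4, (v 0 i == 1) && [forall j : 'I_4, (j < i)%N ==> (v 0 j == 0)]].

Definition npoints (F : finFieldType) (p : mpoly4 F) : nat :=
  #|[set v : 'rV[F]_4 | normalized v & ev4 id p v == 0]|.

(* The F-line spanned by independent a, b lies on S = V(p) iff the binary
   form p(s a + t b) vanishes identically, iff its dehomogenization
   p(X a + b) is the zero polynomial in F[X]. *)
Definition contains_line (F : fieldType) (p : mpoly4 F) (a b : 'rV[F]_4) : bool :=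
  ev4 (fun c : F => c%:P) p (\row_i ((a 0 i)%:P * 'X + (b 0 i)%:P)) == 0.

Definition no_rational_line (F : fieldType) (p : mpoly4 F) : Prop :=
  forall a b : 'rV[F]_4, \rank (col_mx a b) = 2%N -> ~~ contains_line p a b.

(* Main.v *)
Require Import Defs.
From HB Require Import structures.
From mathcomp Require Import all_boot all_order all_algebra all_field.
From mathcomp Require Import mxabelem zify ring.
Set Implicit Arguments. Unset Strict Implicit. Unset Printing Implicit Defensive.
Import Order.TTheory GRing.Theory Num.Theory.
Local Open Scope ring_scope.

(** Let [f] be the quartic form and [U] the set of vectors with [f u = 1]. Over
    F_4 we have [f (c v) = c^4 f v = c f v], so [U] contains exactly one
    representative of each point off the surface, and the claim is
    [#|U| >= 34] as soon as the surface has a rational point.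

    Plane sections. Every line meets [U], since the surface contains no line.
    As [f] has degree 4, a power-sum (Chevalley-Warning) argument gives
    [\sum_u L(u) M(u) = 0] for the sum over the vectors of [U] in a plane and
    any linear forms [L], [M]. Hence a plane with a line on which [f] has no
    zero contains at least 8 points of [U]. In any other plane with [c <= 7]
    points of [U] all lines carry [k] in {1, 2, 3} points, and
    [\sum (k - 1) (k - 3) = (c - 7) (c - 9)] over its 21 lines forces [c = 7] and
    [k] in {1, 3}: the section is the complement of a Baer subplane.

    Space. Suppose [#|U| <= 33]. Averaging over the planes through a rational
    point yields a plane with 7 points of [U]. Counting over the pencil of
    planes through a line shows that every plane has at most 9 points, or
    between 15 and 17 points, and that at most one plane is of the second kind.
    This contradicts [\sum (d - 7) (d - 9) = 5 b^2 - 320 b + 5355 >= 235], where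
    [d] is the number of points in a plane, the sum is over the 85 planes, and
    [b = #|U|]. *)

(** * Pairing of vectors with linear forms *)

Definition dot (F : fieldType) (n : nat) (v w : 'rV[F]_n) : F :=
  \sum_i v 0 i * w 0 i.

Section Dot.
Variables (F : fieldType) (n : nat).
Implicit Types u v w : 'rV[F]_n.

Lemma dotC v w : dot v w = dot w v.
Proof. by apply: eq_bigr => i _; rewrite mulrC. Qed.

Lemma dotDl u v w : dot (u + v) w = dot u w + dot v w.
Proof. by rewrite -big_split; apply: eq_bigr => i _; rewrite mxE mulrDl. Qed.

Lemma dotZl c v w : dot (c *: v) w = c * dot v w.
Proof. by rewrite /dot mulr_sumr; apply: eq_bigr => i _; rewrite mxE mulrA. Qed.

Lemma dotDr u v w : dot u (v + w) = dot u v + dot u w.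
Proof. by rewrite ![dot u _]dotC dotDl. Qed.

Lemma dotZr c v w : dot v (c *: w) = c * dot v w.
Proof. by rewrite ![dot v _]dotC dotZl. Qed.

Lemma dot0l w : dot 0 w = 0.
Proof. by rewrite -(scale0r (0 : 'rV[F]_n)) dotZl mul0r. Qed.

Lemma dot0r w : dot w 0 = 0. Proof. by rewrite dotC dot0l. Qed.

Lemma dot_delta v i : dot v (delta_mx 0 i) = v 0 i.
Proof.
rewrite /dot (bigD1 i) //= mxE !eqxx mulr1 big1 ?addr0 // => j ji.
by rewrite mxE eqxx /= (negPf ji) mulr0.
Qed.

Lemma dot_mulmx v w : (v *m w^T) 0 0 = dot v w.
Proof. by rewrite mxE; apply: eq_bigr => i _; rewrite mxE. Qed.

Lemma mulmx_tr_eq0 v w : (v *m w^T == 0) = (dot v w == 0).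
Proof.
apply/eqP/eqP => [h | h]; first by rewrite -dot_mulmx h mxE.
by apply/matrixP => i j; rewrite !ord1 dot_mulmx h mxE.
Qed.

Lemma rank_pair u v : u != 0 -> (forall c, v <> c *: u) -> \rank (col_mx u v) = 2%N.
Proof.
move=> u0 uv; rewrite -addsmxE.
apply/eqP; rewrite eqn_leq; apply/andP; split.
  by rewrite (leq_trans (mxrank_adds_leqif u v)) // !rank_rV u0; case: (v != 0).
have lt_u : (u < u + v)%MS.
  rewrite ltmxE addsmxSl /=; apply/negP => le_uv.
  have /sub_rVP [c /uv //] : (v <= u)%MS by apply: submx_trans (addsmxSr u v) le_uv.
by have := rank_ltmx lt_u; rewrite rank_rV u0.
Qed.

End Dot.

(** * Power sums over a finite field and sizes of linear subspaces *)

Section PowerSums.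
Variable F : finFieldType.

Lemma natr_card_finField : #|F|%:R = 0 :> F.
Proof.
have : \sum_(x : F) x = \sum_(x : F) (x + 1) by rewrite (reindex_inj (addIr 1)).
rewrite big_split /= sumr_const => /(congr1 (fun y => y - \sum_(x : F) x)).
by rewrite subrr addrAC subrr add0r.
Qed.

(** For positive [k], [X^k - 1] has at most [k] roots, too few to cover the nonzero elements. So
    some nonzero [y] has [y^k] different from 1, and replacing [x] by [y x] multiplies the sum by
    [y^k]. *)
Lemma sum_expr_finField k : (k < #|F|.-1)%N -> \sum_(x : F) x ^+ k = 0.
Proof.
case: k => [|k] ltk.
  by rewrite (eq_bigr (fun=> 1)) // sumr_const natr_card_finField.
have [y y0 yk] : exists2 y : F, y != 0 & y ^+ k.+1 != 1.
  apply/exists_inP; rewrite -[X in is_true X]negbK; apply/negP => /exists_inPn allk.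
  have := @max_unity_roots F k.+1 (enum (predC1 (0 : F))) isT.
  rewrite enum_uniq -cardE cardC1 leqNgt ltk => /(_ _ isT) no; apply: notF; apply: no.
  apply/allP => y; rewrite mem_enum => /allk /negbNE yk.
  by rewrite unity_rootE.
have : \sum_(x : F) x ^+ k.+1 = y ^+ k.+1 * \sum_(x : F) x ^+ k.+1.
  rewrite [LHS](reindex_inj (mulfI y0)) mulr_sumr.
  by apply: eq_bigr => x _; rewrite exprMn.
move/eqP; rewrite -subr_eq0 -{1}[\sum_x _]mul1r -mulrBl mulf_eq0 subr_eq0 eq_sym.
by rewrite (negPf yk) => /eqP.
Qed.

(** The sum factors over the coordinates, with [e j] the exponent of the variable [j]. By pigeonhole
    some exponent is below [#|F| - 1], and its factor is a vanishing power sum. *)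
Lemma sum_monomial n m (g : 'I_m -> 'I_n) : (m < n * #|F|.-1)%N ->
  \sum_(v : 'rV[F]_n) \prod_i v 0 (g i) = 0.
Proof.
move=> ltm; pose e j := #|[set i | g i == j]|.
rewrite (reindex (fun h : {ffun 'I_n -> F} => \row_j h j)) /=; last first.
  exists (fun v : 'rV[F]_n => [ffun j => v 0 j]) => [h _|v _].
    by apply/ffunP => j; rewrite ffunE mxE.
  by apply/rowP => j; rewrite mxE ffunE.
transitivity (\sum_(h : {ffun 'I_n -> F}) \prod_j h j ^+ e j).
  apply: eq_bigr => h _; rewrite (partition_big g xpredT) //=.
  apply: eq_bigr => j _; rewrite -prodr_const.
  by apply: eq_big => [i | i /eqP <-]; rewrite ?inE ?mxE.
rewrite -(bigA_distr_bigA (fun j x => x ^+ e j)).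
have [j ltj] : exists j, (e j < #|F|.-1)%N.
  apply/existsP; rewrite -[X in is_true X]negbK; apply/negP => /existsPn alle.
  have : (\sum_(j < n) #|F|.-1 <= \sum_(j < n) e j)%N.
    by apply: leq_sum => j _; rewrite leqNgt alle.
  rewrite sum_nat_const card_ord => le.
  suff e_m : (\sum_(j < n) e j)%N = m by move: ltm; rewrite ltnNge -{1}e_m le.
  rewrite -[RHS]card_ord -sum1_card (partition_big g xpredT) //=.
  apply: eq_bigr => j _; rewrite /e -sum1_card.
  by apply: eq_bigl => i; rewrite inE.
by rewrite (bigD1 j) //= sum_expr_finField // mul0r.
Qed.

(** Distributing the product gives a combination of monomials of degree [size s], one for each
    choice [g] of a coordinate in every factor. *)
Lemma sum_prod_dot n (s : seq 'rV[F]_n) : (size s < n * #|F|.-1)%N ->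
  \sum_(v : 'rV[F]_n) \prod_(w <- s) dot v w = 0.
Proof.
move=> lts.
under eq_bigr => v _ do rewrite (big_nth 0) big_mkord bigA_distr_bigA.
rewrite exchange_big big1 // => g _ /=.
under eq_bigr => v _ do rewrite big_split /=.
by rewrite -mulr_suml sum_monomial // mul0r.
Qed.

Lemma card_dot_eq0 n (w : 'rV[F]_n) : w != 0 ->
  #|[set v | dot v w == 0]| = (#|F| ^ n.-1)%N.
Proof.
move=> w0; have rk : \rank w^T = 1%N by rewrite mxrank_tr rank_rV w0.
rewrite -subn1 -[X in (n - X)%N]rk -mxrank_ker -card_rowg; apply: eq_card => v.
by rewrite !inE; apply/idP/sub_kermxP; rewrite -mulmx_tr_eq0 => /eqP.
Qed.

Lemma card_dot2_eq0 n (u w : 'rV[F]_n) : u != 0 -> (forall c, w <> c *: u) ->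
  #|[set v | (dot v u == 0) && (dot v w == 0)]| = (#|F| ^ (n - 2))%N.
Proof.
move=> u0 uw.
rewrite -(rank_pair u0 uw) -mxrank_tr tr_col_mx -mxrank_ker -card_rowg.
apply: eq_card => v; rewrite !inE -!mulmx_tr_eq0.
apply/andP/sub_kermxP; rewrite mul_mx_row.
  by case=> /eqP-> /eqP->; rewrite row_mx0.
by move=> h; split; apply/eqP; [rewrite -[LHS](row_mxKl _ (v *m w^T))|
  rewrite -[LHS](row_mxKr (v *m u^T))]; rewrite h ?linear0.
Qed.

End PowerSums.

(** * Incidence counting in projective 3-space over F_4 *)

Section Incidence.
Variable F : finFieldType.
Hypothesis card_F : #|F| = 4%N.
Local Notation V := 'rV[F]_4.
Implicit Types (U A : {set V}) (u v w phi psi : V).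

(* Planes are given by linear forms [dot _ phi], so each plane is counted three
   times in sums over [phi], and the line cut out by [phi] and [psi] is counted
   twelve times in sums over [psi \notin span1 phi]. *)
Definition sec U phi : {set V} := [set u in U | dot u phi == 0].
Definition deg U phi : nat := #|sec U phi|.

Definition proj_distinct U : Prop :=
  forall u, u \in U ->
    u != 0 /\ forall w, w \in U -> w != u -> forall c, w <> c *: u.

Definition span1 phi : {set V} := [set x *: phi | x : F].
Definition span2 phi psi : {set V} := [set z.1 *: phi + z.2 *: psi | z : F * F].

Lemma card_perp w : w != 0 -> #|[set v | dot v w == 0]| = 64%N.
Proof. by move=> w0; rewrite card_dot_eq0 // card_F. Qed.

Lemma card_perp2 u w : u != 0 -> (forall c, w <> c *: u) ->
  #|[set v | (dot v u == 0) && (dot v w == 0)]| = 16%N.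
Proof. by move=> u0 uw; rewrite card_dot2_eq0 // card_F. Qed.

Lemma sum_deg U A :
  (\sum_(phi in A) deg U phi = \sum_(u in U) #|[set phi in A | dot u phi == 0%R]|)%N.
Proof.
under eq_bigr => phi _ do rewrite /deg -sum1_card big_mkcond /=.
rewrite exchange_big /= [RHS]big_mkcond /=; apply: eq_bigr => u _.
rewrite -sum1_card; case: ifP => uU.
  rewrite [RHS]big_mkcond [LHS]big_mkcond /=; apply: eq_bigr => phi _.
  by rewrite !inE uU /=; case: (phi \in A).
by rewrite big1 // => phi _; rewrite inE uU.
Qed.

Lemma proj_distinctS U A : A \subset U -> proj_distinct U -> proj_distinct A.
Proof.
move=> /subsetP sAU dU u /sAU uU; have [u0 du] := dU u uU.
by split=> // w /sAU; apply: du.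
Qed.

Lemma sec_subset U phi : sec U phi \subset U.
Proof. by apply/subsetP => u; rewrite inE => /andP[]. Qed.

Lemma sum_deg_all U : proj_distinct U ->
  (\sum_phi deg U phi = 64 * #|U|)%N.
Proof.
move=> dU; transitivity (\sum_(phi in [set: V]) deg U phi)%N.
  by apply: eq_bigl => phi; rewrite inE.
rewrite sum_deg mulnC -sum_nat_const; apply: eq_bigr => u /dU [u0 _].
rewrite -(card_perp u0).
by apply: eq_card => phi; rewrite !inE dotC.
Qed.

Lemma card_dot2_left (R u : V) : R != 0 -> (forall c, u <> c *: R) ->
  #|[set phi in [set psi | dot R psi == 0] | dot u phi == 0]| = 16%N.
Proof.
move=> R0 Ru; rewrite -(card_perp2 R0 Ru).
by apply: eq_card => phi; rewrite !inE !(dotC phi).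
Qed.

Lemma sum_deg_away U (R : V) : R != 0 -> (forall u, u \in U -> forall c, u <> c *: R) ->
  (\sum_(phi in [set psi | dot R psi == 0%R]) deg U phi = 16 * #|U|)%N.
Proof.
move=> R0 RU; rewrite sum_deg mulnC -sum_nat_const.
by apply: eq_bigr => u uU; apply: card_dot2_left => //; apply: RU.
Qed.

(** All 64 forms vanishing at [u] count [u] itself, and 16 of them vanish at any other given point
    of [U]: the total is 64 + 16 (#|U| - 1). *)
Lemma sum_deg_at U u : proj_distinct U -> u \in U ->
  (\sum_(phi in [set psi | dot u psi == 0%R]) deg U phi = 48 + 16 * #|U|)%N.
Proof.
move=> dU uU; have [u0 du] := dU u uU.
rewrite sum_deg (bigD1 u) //= (eq_bigr (fun=> 16%N)); last first.
  by move=> w /andP[wU wu]; apply: card_dot2_left => //; apply: du.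
rewrite sum_nat_const.
have -> : #|[set phi in [set psi | dot u psi == 0] | dot u phi == 0]| = 64%N.
  rewrite -(card_perp u0).
  by apply: eq_card => phi; rewrite !inE andbb dotC.
have := cardsD1 u U; rewrite uU.
have -> : #|[pred i in U | i != u]| = #|U :\ u|.
  by apply: eq_card => w; rewrite !inE andbC.
by move=> ->; rewrite mulnDr mulnC addnA.
Qed.

(** Both sides count the forms together with an ordered pair of points of [U] at which they
    vanish. *)
Lemma sum_deg_sq U : proj_distinct U ->
  (\sum_phi deg U phi ^ 2 = #|U| * (48 + 16 * #|U|))%N.
Proof.
move=> dU; transitivity (\sum_phi \sum_(u in sec U phi) deg U phi)%N.
  by apply: eq_bigr => phi _; rewrite sum_nat_const mulnn.
rewrite -sum_nat_const.
under eq_bigr => phi _ do rewrite big_mkcond /=.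
rewrite exchange_big [RHS]big_mkcond /=; apply: eq_bigr => u _.
case: ifP => uU; last by rewrite big1 // => phi _; rewrite inE uU.
rewrite -(sum_deg_at dU uU) [RHS]big_mkcond /=.
by apply: eq_bigr => phi _; rewrite !inE uU.
Qed.

(** For independent [phi] and [psi] the right side runs over the five planes through a line: points
    on the line are counted five times, all other points of [U] once. *)
Lemma pencil U phi psi :
  (#|U| + 4 * deg (sec U phi) psi =
   deg U phi + \sum_(x : F) deg U (psi + x *: phi))%N.
Proof.
have degE A chi : deg A chi = (\sum_(u in A) (dot u chi == 0%R))%N.
  by rewrite /deg -sum1_card big_mkcond [RHS]big_mkcond /=; apply: eq_bigr => u _;
    rewrite inE; case: (u \in A).
have -> : deg (sec U phi) psi = (\sum_(u in U) ((dot u phi == 0%R) && (dot u psi == 0%R)))%N.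
  rewrite /deg -sum1_card [RHS]big_mkcond [LHS]big_mkcond /=; apply: eq_bigr => u _.
  by rewrite !inE; case: (u \in U); case: (dot u phi == 0); case: (dot u psi == 0).
have -> : (\sum_(x : F) deg U (psi + x *: phi)%R =
    \sum_(x : F) \sum_(u in U) (dot u (psi + x *: phi)%R == 0%R))%N.
  by apply: eq_bigr => x _; apply: degE.
rewrite degE exchange_big -sum1_card big_distrr /= -!big_split /=.
apply: eq_bigr => u _.
have -> : (\sum_(x : F) (dot u (psi + x *: phi)%R == 0%R))%N =
    #|[set x : F | dot u (psi + x *: phi) == 0]|.
  by rewrite -sum1dep_card [RHS]big_mkcond.
have [h0 | h0] := eqVneq (dot u phi) 0.
  under eq_finset => x do rewrite dotDr dotZr h0 mulr0 addr0.
  case: (dot u psi == 0) => /=; last first.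
    by rewrite (_ : [set _ | false] = set0) ?cards0 //; apply/setP => x; rewrite !inE.
  by rewrite (_ : [set _ | true] = [set: F]) ?cardsT ?card_F //; apply/setP => x; rewrite !inE.
(* Off the plane [phi], exactly one [x] gives a plane through [u]. *)
rewrite /= muln0 addn0 add0n.
rewrite (_ : [set _ | _] = [set - dot u psi / dot u phi]) ?cards1 //.
apply/setP => x; rewrite !inE dotDr dotZr addrC addr_eq0.
by rewrite -(can_eq (mulfK h0) x) divfK.
Qed.

Lemma card_span1 phi : phi != 0 -> #|span1 phi| = 4%N.
Proof.
move=> p0; rewrite card_imset ?card_F // => x y /eqP.
by rewrite -subr_eq0 -scalerBl scaler_eq0 (negPf p0) orbF subr_eq0 => /eqP.
Qed.

Lemma card_span2 phi psi : phi != 0 -> psi \notin span1 phi -> #|span2 phi psi| = 16%N.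
Proof.
move=> p0 pp; rewrite card_imset ?card_prod ?card_F //.
move=> [x y] [x' y'] /= /eqP; rewrite -subr_eq0 opprD addrACA -!scalerBl => /eqP h.
have yy : y - y' = 0.
  apply: contraNeq pp => yy; apply/imsetP; exists (- (x - x') / (y - y')) => //.
  have : (y - y') *: psi = - (x - x') *: phi.
    by apply/eqP; rewrite scaleNr -addr_eq0 addrC h.
  by move/(congr1 ( *:%R (y - y')^-1)); rewrite !scalerA mulVf // scale1r mulrC.
move: h; rewrite yy scale0r addr0 => /eqP.
rewrite scaler_eq0 (negPf p0) orbF subr_eq0 => /eqP ->.
by move/eqP: yy; rewrite subr_eq0 => /eqP ->.
Qed.

Lemma span1_sub2 phi psi : span1 phi \subset span2 phi psi.
Proof.
apply/subsetP => _ /imsetP[x _ ->]; apply/imsetP; exists (x, 0) => //=.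
by rewrite scale0r addr0.
Qed.

Lemma span1_0 phi : 0 \in span1 phi.
Proof. by apply/imsetP; exists 0; rewrite ?scale0r. Qed.

Lemma deg_sec_span1 U phi chi : chi \in span1 phi -> deg (sec U phi) chi = deg U phi.
Proof.
case/imsetP => x _ ->; apply: eq_card => u; rewrite !inE.
by case: (u \in U) => //=; case: eqP => //= h; rewrite dotZr h mulr0 eqxx.
Qed.

Lemma deg_sec_span2 U phi psi chi : chi \in span2 phi psi -> chi \notin span1 phi ->
  deg (sec U phi) chi = deg (sec U phi) psi.
Proof.
case/imsetP => [[x y] _ /= ->] nx; apply: eq_card => u; rewrite !inE.
case: (u \in U) => //=; case: eqP => //= h.
rewrite dotDr !dotZr h mulr0 add0r mulf_eq0; case: eqP => // y0.
by case/negP: nx; rewrite y0 scale0r addr0; apply/imsetP; exists x.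
Qed.

Lemma deg_scale U phi x : x != 0 -> deg U (x *: phi) = deg U phi.
Proof.
by move=> x0; apply: eq_card => u; rewrite !inE dotZr mulf_eq0 (negPf x0).
Qed.

(** In the plane [phi], the five lines through [R] partition the points of [U]; one carries
    [deg (sec U phi) psi] points and the other four at least [m] each. In terms of the 64 forms
    vanishing at [R], with [c] and [k] for the plane and line counts, this reads 16 c >= 4 c + 12 k
    + 48 m. *)
Lemma point_bound U phi psi (R : V) m :
  phi != 0 -> psi \notin span1 phi ->
  R != 0 -> dot R phi = 0 -> dot R psi = 0 ->
  (forall u, u \in U -> forall c, u <> c *: R) ->
  (forall chi, chi \notin span1 phi -> m <= deg (sec U phi) chi)%N ->
  (deg (sec U phi) psi + 4 * m <= deg U phi)%N.
Proof.
move=> p0 pp R0 Rp Rpsi RU hm.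
pose H := [set chi | dot R chi == 0].
have sH : span2 phi psi \subset H.
  by apply/subsetP => _ /imsetP[z _ ->]; rewrite inE dotDr !dotZr Rp Rpsi !mulr0 addr0.
have cH : #|H| = 64%N.
  rewrite -(card_perp R0).
  by apply: eq_card => chi; rewrite !inE dotC.
have RU' u : u \in sec U phi -> forall c, u <> c *: R.
  by rewrite inE => /andP[/RU].
have := sum_deg_away R0 RU'; rewrite -/H.
rewrite (big_setID (span2 phi psi)) /= (setIidPr sH).
rewrite (big_setID (span1 phi)) /= (setIidPr (span1_sub2 _ _)).
rewrite (eq_bigr (fun=> deg U phi)); last by move=> chi; apply: deg_sec_span1.
rewrite sum_nat_const card_span1 //.
rewrite (eq_bigr (fun=> deg (sec U phi) psi)); last first.
  by move=> chi /setDP[h1 h2]; apply: deg_sec_span2.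
have h3 : (\sum_(i in H :\: span2 phi psi) deg (sec U phi) i >=
    \sum_(i in H :\: span2 phi psi) m)%N.
  apply: leq_sum => chi /setDP[_ h]; apply: hm.
  by apply: contra h; apply/subsetP/span1_sub2.
move: h3; rewrite !sum_nat_const !cardsD (setIidPr sH) (setIidPr (span1_sub2 _ _)).
rewrite card_span2 // card_span1 // cH /deg.
move: (\sum_(i in _) _)%N #|sec (sec U phi) psi| #|sec U phi| => s k c.
by clear; lia.
Qed.

Lemma sum_intr (I : finType) (P : pred I) (g : I -> nat) :
  (\sum_(i | P i) g i)%N%:Z = \sum_(i | P i) (g i)%:Z.
Proof. by rewrite -natz natr_sum; apply: eq_bigr => i _; rewrite natz. Qed.

Lemma sum_quadratic (A : {set V}) (g : V -> nat) (a b : int) :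
  \sum_(i in A) ((g i)%:Z - a) * ((g i)%:Z - b) =
  (\sum_(i in A) g i ^ 2)%N%:Z - (a + b) * (\sum_(i in A) g i)%N%:Z + a * b * #|A|%:Z.
Proof.
rewrite !sum_intr mulr_sumr -sumrB.
have -> : a * b * #|A|%:Z = \sum_(i in A) a * b.
  by rewrite sumr_const -mulr_natr natz.
rewrite -big_split /=; apply: eq_bigr => i _.
by rewrite -mulnn PoszM; ring.
Qed.

(** The first two moments over all 256 forms are known. Removing the four multiples of [phi], each
    of which sees the whole section, leaves 60 c and 12 c^2 + 48 c over 252 forms, that is 21 lines
    with multiplicity 12. *)
Lemma plane_moment U phi : proj_distinct U -> phi != 0 ->
  let c := (deg U phi)%:Z in
  \sum_(psi in ~: span1 phi)
     ((deg (sec U phi) psi)%:Z - 1) * ((deg (sec U phi) psi)%:Z - 3) =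
  12%:Z * ((c - 7) * (c - 9)).
Proof.
move=> dU p0 c; have dS := proj_distinctS (sec_subset U phi) dU.
rewrite sum_quadratic.
have sC (g : V -> nat) : (\sum_psi g psi =
    \sum_(psi in span1 phi) g psi + \sum_(psi in ~: span1 phi) g psi)%N.
  rewrite (bigID [in span1 phi]) /=; congr (_ + _)%N.
  by apply: eq_bigl => psi; rewrite inE.
have := sum_deg_all dS; have := sum_deg_sq dS; rewrite !sC.
have e1 : (\sum_(psi in span1 phi) deg (sec U phi) psi = 4 * deg U phi)%N.
  rewrite (eq_bigr (fun=> deg U phi)) ?sum_nat_const ?card_span1 //.
  by move=> chi /deg_sec_span1.
have e2 : (\sum_(psi in span1 phi) deg (sec U phi) psi ^ 2 = 4 * deg U phi ^ 2)%N.
  rewrite (eq_bigr (fun=> deg U phi ^ 2)%N) ?sum_nat_const ?card_span1 //.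
  by move=> chi /deg_sec_span1 ->.
rewrite e1 e2.
have := cardsC (span1 phi); rewrite card_span1 // card_mx card_F -[(4 ^ _)%N]/256%N.
rewrite -/(deg U phi) => h1 h2 h3.
have -> : #|~: span1 phi| = 252%N by lia.
rewrite /c; move: h2 h3.
set s2 := (\sum_(i in _) _ ^ 2)%N; set s1 := (\sum_(i in _) _)%N.
move: (deg U phi) => d h2 h3.
have -> : s1 = (60 * d)%N by lia.
have -> : s2 = (12 * d ^ 2 + 48 * d)%N by nia.
by rewrite -mulnn; lia.
Qed.

(** As in the plane, with only the zero form removed: 63 b and 15 b^2 + 48 b over 255 forms, that is
    85 planes with multiplicity 3. *)
Lemma space_moment U : proj_distinct U ->
  let b := #|U|%:Z in
  \sum_(phi in [set~ 0]) ((deg U phi)%:Z - 7) * ((deg U phi)%:Z - 9) =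
  15 * b ^+ 2 - 960 * b + 16065.
Proof.
move=> dU b; rewrite sum_quadratic.
have d0 : deg U 0 = #|U|.
  by apply: eq_card => u; rewrite !inE dot0r eqxx andbT.
have := sum_deg_all dU; have := sum_deg_sq dU.
rewrite (bigD1 0) //= [in X in _ -> X -> _](bigD1 0) //= d0.
rewrite cardsC1 card_mx card_F -[(4 ^ _).-1]/255%N.
have e (g : V -> nat) : (\sum_(i in [set~ 0%R]) g i = \sum_(i | i != 0%R) g i)%N.
  by apply: eq_bigl => i; rewrite !inE.
rewrite !e; set s2 := (\sum_(i | _) _ ^ 2)%N; set s1 := (\sum_(i | _) _)%N.
rewrite /b; move: #|U| => d h2 h3.
have -> : s1 = (63 * d)%N by lia.
have -> : s2 = (15 * d ^ 2 + 48 * d)%N by nia.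
by rewrite -mulnn; lia.
Qed.

End Incidence.

(** * Plane sections of the set where the quartic takes the value 1 *)

Section QuarticFunction.
Variable F : finFieldType.
Hypothesis card_F : #|F| = 4%N.
Local Notation V := 'rV[F]_4.
Variable f : V -> F.
Let U : {set V} := [set u | f u == 1].

(** These three properties represent the quartic in the counting argument. They are derived from the
    polynomial in the last section: from c^4 = c, from power sums, and from the absence of rational
    lines. *)
Hypothesis fZ : forall c v, f (c *: v) = c * f v.
Hypothesis f_orth : forall phi L M : V,
  \sum_(u in sec U phi) dot u L * dot u M = 0.
Hypothesis f_line : forall phi psi : V, phi != 0 -> psi \notin span1 phi ->
  exists v, [/\ dot v phi = 0, dot v psi = 0 & f v != 0].

Implicit Types (u v phi psi L M R : V).

Lemma two_eq0 : 2 = 0 :> F.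
Proof.
have := natr_card_finField F; rewrite card_F (natrM _ 2 2) => /eqP.
by rewrite mulf_eq0 orbb => /eqP.
Qed.

Lemma cube_eq1 (x : F) : x != 0 -> x ^+ 3 = 1.
Proof.
move=> x0; apply: (mulfI x0); rewrite mulr1 -exprS.
by have := expf_card x; rewrite card_F.
Qed.

Lemma mem_U v : f v != 0 -> (f v)^-1 *: v \in U.
Proof. by move=> h; rewrite inE fZ mulVf. Qed.

Lemma U_distinct : proj_distinct U.
Proof.
move=> u; rewrite inE => /eqP fu; split.
  apply/eqP => u0; move: fu; rewrite u0 -(scale0r (0 : V)) fZ mul0r => /esym/eqP.
  by rewrite oner_eq0.
move=> w; rewrite inE => /eqP fw /eqP wu c wc; apply: wu; move: fw.
by rewrite wc fZ fu mulr1 => ->; rewrite scale1r.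
Qed.

Lemma U_away R : f R = 0 -> forall u, u \in U -> forall c, u <> c *: R.
Proof.
move=> fR u; rewrite inE => /eqP fu c uc; move: fu; rewrite uc fZ fR mulr0.
by move/esym/eqP; rewrite oner_eq0.
Qed.

Lemma notin_span1 phi psi : psi \notin span1 phi -> forall c, psi <> c *: phi.
Proof. by move=> h c e; case/negP: h; apply/imsetP; exists c. Qed.

Lemma span1_sym phi psi : phi != 0 -> psi \notin span1 phi -> phi \notin span1 psi.
Proof.
move=> p0 pp; apply/negP => /imsetP[x _ e]; case/negP: pp; apply/imsetP.
have x0 : x != 0 by apply: contra_neq p0 => x0; rewrite e x0 scale0r.
by exists x^-1 => //; rewrite e scalerA mulVf // scale1r.
Qed.

Lemma deg_sec_ge1 phi psi : phi != 0 -> psi \notin span1 phi ->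
  (1 <= deg (sec U phi) psi)%N.
Proof.
move=> p0 pp; have [v [v1 v2 v3]] := f_line p0 pp.
apply/card_gt0P; exists ((f v)^-1 *: v); rewrite /sec !inE !dotZl v1 v2 mulr0 eqxx.
by rewrite !andbT; have := mem_U v3; rewrite inE.
Qed.

Lemma deg_secC phi psi : deg (sec U phi) psi = deg (sec U psi) phi.
Proof. by apply: eq_card => u; rewrite !inE -!andbA [_ && (dot u psi == 0)]andbC. Qed.

(** All planes of the pencil share one line, so a line count can be read off in any of them. *)
Lemma deg_sec_shift phi psi x :
  deg (sec U (psi + x *: phi)) phi = deg (sec U phi) psi.
Proof.
rewrite deg_secC; apply: eq_card => u; rewrite !inE.
by case: (f u == 1) => //=; case: eqP => //= h; rewrite dotDr dotZr h mulr0 addr0.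
Qed.

Lemma card_unitF : #|[set~ 0 : F]| = 3%N.
Proof. by rewrite cardsC1 card_F. Qed.

(** The nonzero multiples of points of [U] on the line are distinct among its 15 nonzero vectors,
    three for each point. *)
Lemma deg_sec_le5 phi psi : phi != 0 -> psi \notin span1 phi ->
  (deg (sec U phi) psi <= 5)%N.
Proof.
move=> p0 pp; set K := sec (sec U phi) psi.
have := card_perp2 card_F p0 (notin_span1 pp).
rewrite (cardsD1 0) inE !dot0l !eqxx /=.
set N := _ :\ 0 => cN.
suff : (#|setX [set~ 0%R : F] K| <= #|N|)%N.
  by rewrite cardsX card_unitF /deg -/K; move: #|N| #|K| cN; clear; lia.
pose g (z : F * V) := z.1 *: z.2.
have inj_g : {in setX [set~ 0] K &, injective g}.
  move=> [c u] [c' u'] /setXP[/= _ uK] /setXP[/= c'0 uK'] e.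
  have [uU uU'] : f u = 1 /\ f u' = 1.
    by move: uK uK'; rewrite !inE => /andP[/andP[/eqP-> _] _] /andP[/andP[/eqP-> _] _].
  have := congr1 f e; rewrite /g /= !fZ uU uU' !mulr1 => cc.
  rewrite cc; congr pair; move: e; rewrite /g /= cc.
  by apply: scalerI; move: c'0; rewrite !inE.
rewrite -(card_in_imset inj_g); apply/subset_leq_card/subsetP.
move=> _ /imsetP[[c u] /setXP[/= c0 uK] ->]; rewrite /g /=.
have uU : u \in U by apply: (subsetP (sec_subset U phi)); apply: (subsetP (sec_subset _ psi)).
have [u0 _] := U_distinct uU.
move: c0 uK; rewrite !inE !dotZl scaler_eq0 (negPf u0) orbF => -> /andP[/andP[_ /eqP->] /eqP->].
by rewrite mulr0 eqxx.
Qed.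

Definition zero_free phi psi : Prop :=
  forall v, v != 0 -> dot v phi = 0 -> dot v psi = 0 -> f v != 0.

Lemma zero_freePn phi psi :
  zero_free phi psi \/ exists R, [/\ R != 0, dot R phi = 0, dot R psi = 0 & f R = 0].
Proof.
case: (boolP [exists R, [&& R != 0, dot R phi == 0, dot R psi == 0 & f R == 0]]).
  by case/existsP => R /and4P[? /eqP ? /eqP ? /eqP ?]; right; exists R.
move/existsPn => h; left => v v0 v1 v2.
by have := h v; rewrite v0 v1 v2 !eqxx.
Qed.

(** Each of the 15 nonzero vectors [v] of the line is [f v] times a point of [U], and a point of [U]
    has three nonzero multiples. *)
Lemma zero_free_deg phi psi : phi != 0 -> psi \notin span1 phi ->
  zero_free phi psi -> (5 <= deg (sec U phi) psi)%N.
Proof.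
move=> p0 pp zf; set K := sec (sec U phi) psi.
have := card_perp2 card_F p0 (notin_span1 pp).
rewrite (cardsD1 0) inE !dot0l !eqxx /=.
set N := _ :\ 0 => cN.
suff : (#|N| <= #|setX [set~ 0%R : F] K|)%N.
  by rewrite cardsX card_unitF /deg -/K; move: #|N| #|K| cN; clear; lia.
pose g (z : F * V) := z.1 *: z.2.
apply: leq_trans (leq_imset_card g _); apply/subset_leq_card/subsetP => v.
rewrite !inE => /and3P[v0 /eqP v1 /eqP v2]; have fv := zf v v0 v1 v2.
apply/imsetP; exists (f v, (f v)^-1 *: v); last by rewrite /g /= scalerA mulfV // scale1r.
apply/setXP; split => /=; first by rewrite !inE.
rewrite !inE !dotZl v1 v2 mulr0 eqxx !andbT.
by have := mem_U fv; rewrite inE.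
Qed.

(** Otherwise the 64 vectors orthogonal to [u] would all be orthogonal to [v], but only 16 are
    orthogonal to both. *)
Lemma separate u v : u != 0 -> (forall c, v <> c *: u) ->
  exists L, dot u L = 0 /\ dot v L = 1.
Proof.
move=> u0 uv.
have [L L1 L2] : exists2 L, L \in [set w | dot w u == 0] & dot L v != 0.
  apply/exists_inP; rewrite -[X in is_true X]negbK; apply/negP => /exists_inPn h.
  suff e : #|[set w | dot w u == 0]| = #|[set w | (dot w u == 0) && (dot w v == 0)]|.
    by move: e; rewrite card_perp // card_perp2.
  apply: eq_card => w; rewrite !inE; have := h w; rewrite inE.
  by case: (dot w u == 0) => // /(_ isT); rewrite negbK => ->.
exists ((dot L v)^-1 *: L); rewrite !dotZr ![dot _ L]dotC mulVf //.
by move: L1; rewrite inE => /eqP ->; rewrite mulr0.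
Qed.

(* On a zero-free line with dual coordinates (x, y) the form x^2 + xy + y^2
   vanishes at the two points with y/x a primitive cube root of unity, and its
   values at a and b cancel, so only the point of a + b contributes. *)
Lemma zero_free_off_line phi psi : phi != 0 -> psi \notin span1 phi ->
  zero_free phi psi -> sec U phi <> sec (sec U phi) psi.
Proof.
move=> p0 pp zf eK; set K := sec (sec U phi) psi in eK *.
have KU u : u \in K -> u \in U.
  by rewrite -eK => uK; apply: (subsetP (sec_subset U phi)).
have Kperp u : u \in K -> dot u phi = 0 /\ dot u psi = 0.
  by rewrite !inE => /andP[/andP[_ /eqP->] /eqP->].
have /card_gt1P[a [b [aK bK ab]]] : (1 < #|K|)%N.
  by apply: leq_trans (zero_free_deg p0 pp zf).
have [a0 da] := U_distinct (KU _ aK); have [b0 db] := U_distinct (KU _ bK).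
have dab : forall c, b <> c *: a by apply: da; [apply: KU | rewrite eq_sym].
have dba : forall c, a <> c *: b by apply: db; [apply: KU |].
have [be [a_be b_be]] := separate a0 dab.
have [al [b_al a_al]] := separate b0 dba.
have [[a1 a2] [b1 b2]] := (Kperp _ aK, Kperp _ bK).
have span_ab u : u \in K -> u = dot u al *: a + dot u be *: b.
  (* One inclusion suffices, as both sides have 16 elements. *)
  have e : span2 a b = [set v | (dot v phi == 0) && (dot v psi == 0)].
    apply/eqP; rewrite eqEcard; apply/andP; split.
      apply/subsetP => _ /imsetP[z _ ->]; rewrite inE !dotDl !dotZl a1 a2 b1 b2.
      by rewrite !mulr0 addr0 eqxx.
    rewrite card_perp2 //; last exact: notin_span1.
    rewrite card_span2 //; apply/negP => /imsetP[c _]; exact: dab.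
  move=> uK; have : u \in span2 a b.
    by rewrite e inE; have [-> ->] := Kperp _ uK; rewrite eqxx.
  case/imsetP => [[x y] _ /= ->]; rewrite !dotDl !dotZl a_al a_be b_al b_be.
  by rewrite !mulr0 !mulr1 addr0 add0r.
have fab : f (a + b) != 0.
  apply: zf; rewrite ?dotDl ?a1 ?a2 ?b1 ?b2 ?addr0 //.
  apply/eqP => ab0; apply: (dab (-1)); rewrite scaleN1r.
  by apply/eqP; rewrite -addr_eq0 addrC ab0.
pose e := (f (a + b))^-1 *: (a + b).
have eK' : e \in K.
  rewrite !inE !dotZl !dotDl a1 a2 b1 b2 addr0 mulr0 eqxx !andbT.
  by have := mem_U fab; rewrite inE.
have e_al : dot e al = (f (a + b))^-1 by rewrite dotZl dotDl a_al b_al addr0 mulr1.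
have e_be : dot e be = (f (a + b))^-1 by rewrite dotZl dotDl a_be b_be add0r mulr1.
pose g u := dot u al * dot u al + dot u al * dot u be + dot u be * dot u be.
have sum_g : \sum_(u in K) g u = 0.
  by rewrite !big_split /= -eK !f_orth !addr0.
have ea : e != a.
  by apply: contraNneq fab => ea; rewrite -invr_eq0 -e_be ea a_be.
have eb : e != b.
  by apply: contraNneq fab => eb; rewrite -invr_eq0 -e_al eb b_al.
move: sum_g; rewrite (bigD1 a) //= (bigD1 b) /=; last by rewrite bK eq_sym.
rewrite (bigD1 e) /=; last by rewrite eK' ea.
rewrite big1 => [|u /andP[/andP[/andP[uK ua] ub] ue]].
  rewrite /g a_al a_be b_al b_be e_al e_be !mulr0 !mul0r !mulr1 !addr0 !add0r.
  set t := (f (a + b))^-1; have t0 : t != 0 by rewrite invr_eq0.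
  move/eqP; apply/negP.
  have -> : 1 + (1 + (t * t + t * t + t * t)) = t * t + 2 * (1 + t * t) by ring.
  by rewrite two_eq0 mul0r addr0 mulf_neq0.
have [_ du] := U_distinct (KU _ uK).
have eu := span_ab _ uK; rewrite /g; set x := dot u al in eu *; set y := dot u be in eu *.
have x0 : x != 0.
  apply/eqP => x0; apply: (db u (KU _ uK) ub y).
  by rewrite {1}eu x0 scale0r add0r.
have y0 : y != 0.
  apply/eqP => y0; apply: (da u (KU _ uK) ua x).
  by rewrite {1}eu y0 scale0r addr0.
have xy : x - y != 0.
  rewrite subr_eq0; apply/eqP => xy.
  have [_ de] := U_distinct (KU _ eK').
  apply: (de u (KU _ uK) ue (x * f (a + b))).
  by rewrite /e scalerA mulfK // scalerDr {2}xy.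
apply: (mulfI xy); rewrite mulr0.
have -> : (x - y) * (x * x + x * y + y * y) = x ^+ 3 - y ^+ 3 by ring.
by rewrite !cube_eq1 // subrr.
Qed.

(** The line carries at least 5 points, so with fewer than 8 in the plane at most two, forming [T],
    lie off it. Orthogonality to [psi] makes the sum over [T] of [psi] times any form vanish. One
    point is excluded by the form [psi] itself, two by a form separating them, and none by
    [zero_free_off_line]. *)
Lemma zero_free_plane phi psi : phi != 0 -> psi \notin span1 phi ->
  zero_free phi psi -> (8 <= deg U phi)%N.
Proof.
move=> p0 pp zf; rewrite leqNgt; apply/negP => lt8.
pose K := sec (sec U phi) psi; pose T := sec U phi :\: K.
have sK : K \subset sec U phi by apply: sec_subset.
have K5 : (5 <= #|K|)%N := zero_free_deg p0 pp zf.
have cT : #|T| = (deg U phi - #|K|)%N by rewrite cardsD (setIidPr sK).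
have T3 : (#|T| < 3)%N by move: lt8 K5 cT; move: #|T| #|K| (deg U phi); clear; lia.
have T_psi u : u \in T -> u \in U /\ dot u psi != 0.
  case/setDP => uS; rewrite inE uS /= => ->; split=> //.
  exact: (subsetP (sec_subset U phi)).
have sumT L : \sum_(u in T) dot u psi * dot u L = 0.
  transitivity (\sum_(u in sec U phi) dot u psi * dot u L); last exact: f_orth.
  rewrite [RHS](big_setID K) /= (setIidPr sK).
  by rewrite [X in X + _]big1 ?add0r // => u; rewrite inE => /andP[_ /eqP->]; rewrite mul0r.
have T0 : #|T| != 0%N.
  apply/negP => /eqP/cards0_eq/eqP; rewrite setD_eq0 => sS.
  case: (zero_free_off_line p0 pp zf); apply/eqP; rewrite eqEsubset sS.
  exact: sK.
case: (ltngtP #|T| 1) => [|T2|/eqP/cards1P[u eT]].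
- by rewrite ltnS leqn0 (negPf T0).
- have /eqP/cards2P[u [v [uv eT]]] : #|T| = 2%N by apply/eqP; rewrite eqn_leq -ltnS T3.
  have [[uU u_psi] [vU _]] : (u \in U /\ dot u psi != 0) /\ (v \in U /\ dot v psi != 0).
    by split; apply: T_psi; rewrite eT !inE eqxx ?orbT.
  have [v0 dv] := U_distinct vU.
  have [L [vL uL]] := separate v0 (dv u uU uv).
  have := sumT L; rewrite eT big_setU1 ?inE //= big_set1 vL uL mulr1 mulr0 addr0.
  by apply/eqP.
have [_ u_psi] : u \in U /\ dot u psi != 0 by apply: T_psi; rewrite eT !inE.
by have /eqP := sumT psi; rewrite eT big_set1 mulf_eq0 (negPf u_psi).
Qed.

(** With at most 7 points no line is zero-free, so each line has a zero of [f]; through it pass four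
    further lines with a point each, and k + 4 <= 7. Every term (k - 1) (k - 3) is then nonpositive,
    hence so is (c - 7) (c - 9). This gives c = 7, the sum is zero, and each term vanishes. *)
Lemma plane_cases phi : phi != 0 ->
  (8 <= deg U phi)%N \/
  deg U phi = 7%N /\ forall psi, psi \notin span1 phi ->
    deg (sec U phi) psi = 1%N \/ deg (sec U phi) psi = 3%N.
Proof.
move=> p0; case: (leqP 8 (deg U phi)) => [|lt8]; [by left | right].
have k13 psi : psi \notin span1 phi -> (1 <= deg (sec U phi) psi <= 3)%N.
  move=> pp; rewrite deg_sec_ge1 //=.
  case: (zero_freePn phi psi) => [/(zero_free_plane p0 pp)|]; first by rewrite leqNgt lt8.
  case=> R [R0 R1 R2 fR].
  have := point_bound card_F p0 pp R0 R1 R2 (U_away fR) (fun chi => deg_sec_ge1 p0).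
  by move: lt8; clear; lia.
have := plane_moment card_F U_distinct p0; rewrite /=.
pose t psi : int := ((deg (sec U phi) psi)%:Z - 1) * ((deg (sec U phi) psi)%:Z - 3).
have t_le0 psi : psi \in ~: span1 phi -> t psi <= 0.
  rewrite inE => /k13; rewrite /t; move: (deg _ psi) => k; clear; nia.
have S_le0 : \sum_(psi in ~: span1 phi) t psi <= 0 by apply: sumr_le0.
rewrite -/(\sum_(psi in ~: span1 phi) t psi) => St; rewrite St in S_le0.
have d7 : deg U phi = 7%N by move: S_le0 lt8; clear; move: (deg U phi) => d; nia.
split=> // psi pp.
have : \sum_(psi in ~: span1 phi) - t psi = 0 by rewrite sumrN St d7.
move/eqP; rewrite psumr_eq0; last by move=> chi /t_le0; rewrite oppr_ge0.
move/allP/(_ psi (mem_index_enum _)); rewrite inE pp /= oppr_eq0 /t.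
have := k13 _ pp; move: (deg _ psi) => k; clear; nia.
Qed.

Lemma deg_ge7 phi : phi != 0 -> (7 <= deg U phi)%N.
Proof. by case/plane_cases => [/ltnW | [->]]. Qed.

Lemma sum_pencil_ge phi psi (P : pred F) m :
  (forall x, P x -> m <= deg U (psi + x *: phi))%N ->
  (#|P| * m <= \sum_(x | P x) deg U (psi + x *: phi)%R)%N.
Proof. by move=> h; rewrite -sum_nat_const; apply: leq_sum. Qed.

(** * The count in space when [U] has at most 33 points *)

Section FewNonzeros.
Hypothesis card_U : (#|U| <= 33)%N.
Variable R0 : V.
Hypotheses (R0_neq0 : R0 != 0) (f_R0 : f R0 = 0).

(** If all planes through the zero [R0] had at least 8 points, the 63 nonzero forms vanishing there
    would give 16 #|U| >= #|U| + 504, which fails for #|U| <= 33. *)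
Lemma small_plane : exists2 phi, phi != 0 & deg U phi = 7%N.
Proof.
case: (boolP [exists phi, (phi != 0) && (deg U phi == 7%N)]).
  by case/existsP => phi /andP[? /eqP ?]; exists phi.
move/existsPn => no7; exfalso.
have := sum_deg_away card_F R0_neq0 (U_away f_R0).
set H := [set psi | _]; have H0 : 0 \in H by rewrite inE dot0r.
have cH : #|H| = 64%N.
  by rewrite -(card_perp card_F R0_neq0); apply: eq_card => v; rewrite !inE dotC.
have d0 : deg U 0 = #|U| by apply: eq_card => u; rewrite !inE dot0r eqxx andbT.
rewrite (big_setD1 0) //= d0.
have : (\sum_(phi in H :\ 0%R) 8 <= \sum_(phi in H :\ 0%R) deg U phi)%N.
  apply: leq_sum => phi /setD1P[p0 _]; have := no7 phi; rewrite p0 /=.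
  by case: (plane_cases p0) => [|[->]].
rewrite sum_nat_const; move: cH; rewrite (cardsD1 0) H0.
move: (\sum_(phi in _) _)%N #|H :\ 0| card_U; move: #|U|; clear; lia.
Qed.

Lemma shift_neq0 phi psi x : psi \notin span1 phi -> psi + x *: phi != 0.
Proof.
move=> pp; apply: contraNneq pp => h; apply/imsetP; exists (- x) => //.
by apply/eqP; rewrite scaleNr -addr_eq0 h.
Qed.

Lemma notin_span1_shift phi psi x : phi != 0 -> psi \notin span1 phi ->
  phi \notin span1 (psi + x *: phi).
Proof.
move=> p0 pp; apply: span1_sym; first exact: p0.
apply: contra pp => /imsetP[y _ e]; apply/imsetP; exists (y - x) => //.
by rewrite scalerBl -e addrK.
Qed.

(** A plane with 7 points has only lines with 1 or 3 points, so no such plane contains the given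
    line. *)
Lemma deg_ge8 phi psi x : phi != 0 -> psi \notin span1 phi ->
  deg (sec U phi) psi != 1%N -> deg (sec U phi) psi != 3%N ->
  (8 <= deg U (psi + x *: phi))%N.
Proof.
move=> p0 pp k1 k3; case: (plane_cases (shift_neq0 x pp)) => // -[_ /(_ phi)].
rewrite notin_span1_shift // deg_sec_shift => /(_ isT).
by case=> e; [rewrite e in k1 | rewrite e in k3].
Qed.

(** The pencil of a line with 1 point would need 33 + 4 >= 10 + 4 * 7. With 2 points the other four
    planes have at least 8 points each, requiring 33 + 8 >= 10 + 4 * 8. *)
Lemma big_plane_lines phi psi : phi != 0 -> (10 <= deg U phi)%N ->
  psi \notin span1 phi -> (3 <= deg (sec U phi) psi)%N.
Proof.
move=> p0 d10 pp; rewrite ltnNge; apply/negP => k2.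
have k1 := deg_sec_ge1 p0 pp; have := pencil card_F U phi psi.
have := @sum_pencil_ge phi psi xpredT 7 (fun x _ => deg_ge7 (shift_neq0 x pp)).
rewrite card_F.
have [e1 | n1] := eqVneq (deg (sec U phi) psi) 1%N.
  rewrite e1; move: (\sum_(x : F) _)%N d10 card_U; move: #|U| (deg U phi); clear; lia.
have n3 : deg (sec U phi) psi != 3%N by move: k2; clear; lia.
have := @sum_pencil_ge phi psi xpredT 8 (fun x _ => deg_ge8 x p0 pp n1 n3).
rewrite card_F.
move: (\sum_(x : F) _)%N d10 card_U k1 k2; move: #|U| (deg U phi) (deg _ psi); clear; lia.
Qed.

(** A plane with 7 points meets this one in a line with exactly 3 points, which therefore contains a
    zero of [f]. The lines through that zero give at least 3 + 4 * 3 points, and the pencil of the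
    line at most 33 + 12 - 4 * 7. *)
Lemma big_plane_deg phi : phi != 0 -> (10 <= deg U phi)%N -> (15 <= deg U phi <= 17)%N.
Proof.
move=> p0 d10; have [psi q0 d7] := small_plane.
have pp : psi \notin span1 phi.
  apply/negP => /imsetP[x _ e]; move: d7; rewrite e deg_scale; first by move: d10; clear; lia.
  by apply: contra_neq q0 => x0; rewrite e x0 scale0r.
have k3 : deg (sec U phi) psi = 3%N.
  have := big_plane_lines p0 d10 pp.
  case: (plane_cases q0) => [|[_ /(_ phi (span1_sym p0 pp))]]; first by rewrite d7.
  by rewrite deg_secC => -[] ->.
apply/andP; split.
  case: (zero_freePn phi psi) => [/(zero_free_deg p0 pp)|]; first by rewrite k3.
  case=> R [R_0 R1 R2 fR].
  have := point_bound card_F p0 pp R_0 R1 R2 (U_away fR) (fun chi => big_plane_lines p0 d10).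
  by rewrite k3.
have := pencil card_F U phi psi.
have := @sum_pencil_ge phi psi xpredT 7 (fun x _ => deg_ge7 (shift_neq0 x pp)).
rewrite card_F k3.
move: (\sum_(x : F) _)%N card_U; move: #|U| (deg U phi); clear; lia.
Qed.

(** The common line of two such planes has 3, 4 or 5 points. Its pencil would need 33 + 12 >= 30 + 3
    * 7 for 3 points, and 33 + 20 >= 30 + 3 * 8 at best otherwise. *)
Lemma big_plane_unique phi psi : phi != 0 -> (10 <= deg U phi)%N ->
  psi != 0 -> (10 <= deg U psi)%N -> psi \in span1 phi.
Proof.
move=> p0 d10 q0 e10; apply/negPn/negP => pp.
have /andP[d15 _] := big_plane_deg p0 d10; have /andP[e15 _] := big_plane_deg q0 e10.
have k3 := big_plane_lines p0 d10 pp; have k5 := deg_sec_le5 p0 pp.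
have := pencil card_F U phi psi; rewrite (bigD1 0) //= scale0r addr0.
have cP : #|[pred x : F | x != 0]| = 3%N.
  by rewrite -card_unitF; apply: eq_card => x; rewrite !inE.
have := @sum_pencil_ge phi psi [pred x | x != 0] 7 (fun x _ => deg_ge7 (shift_neq0 x pp)).
rewrite cP /=.
have [e3 | n3] := eqVneq (deg (sec U phi) psi) 3%N.
  rewrite e3; move: (\sum_(x : F | _) _)%N d15 e15 card_U.
  by move: #|U| (deg U phi) (deg U psi); clear; lia.
have n1 : deg (sec U phi) psi != 1%N by move: k3; clear; lia.
have := @sum_pencil_ge phi psi [pred x | x != 0] 8 (fun x _ => deg_ge8 x p0 pp n1 n3).
rewrite cP /=.
move: (\sum_(x : F | _) _)%N d15 e15 card_U k5.
by move: #|U| (deg U phi) (deg U psi) (deg _ psi); clear; lia.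
Qed.

Lemma few_nonzeros_absurd : False.
Proof.
have := space_moment card_F U_distinct; rewrite /=.
pose t phi : int := ((deg U phi)%:Z - 7) * ((deg U phi)%:Z - 9).
rewrite -/(\sum_(phi in [set~ 0]) t phi) => St.
(* This is 3 * 235, the minimum of the quadratic, attained at [b] = 32. *)
have St_ge : 705 <= \sum_(phi in [set~ 0]) t phi.
  rewrite St -subr_ge0; move: #|U|%:Z => b.
  have -> : 15 * b ^+ 2 - 960 * b + 16065 - 705 = 15 * (b - 32) ^+ 2 by ring.
  by rewrite mulr_ge0 ?sqr_ge0.
pose Bg := [set phi : V | (phi != 0) && (10 <= deg U phi)%N].
have cB : (#|Bg| <= 3)%N.
  have [-> | [phi]] := set_0Vmem Bg; first by rewrite cards0.
  rewrite inE => /andP[p0 d10].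
  have : Bg \subset span1 phi :\ 0.
    apply/subsetP => psi; rewrite !inE => /andP[q0 e10]; rewrite q0.
    exact: big_plane_unique.
  move/subset_leq_card/leq_trans; apply.
  by have := cardsD1 0 (span1 phi); rewrite span1_0 card_span1 // => -[]; rewrite add0n => <-.
(* Terms with 7 to 9 points are nonpositive; between 15 and 17 points the maximum is (17 - 7) (17 -
   9) = 80. At most three proportional forms contribute, so the sum is at most 240. *)
have St_le : \sum_(phi in [set~ 0]) t phi <= \sum_(phi in [set~ 0]) (80 * (phi \in Bg)%:Z).
  apply: ler_sum => phi; rewrite !inE => p0; rewrite p0 /= /t.
  have d7 := deg_ge7 p0.
  have := @big_plane_deg phi p0; move: d7; move: (deg U phi) => d.
  case: (leqP 10 d) => h d7; last by move=> _; move: h d7; clear; nia.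
  by move=> /(_ isT) /andP[d15 d17]; move: d15 d17; clear; nia.
have S80 : \sum_(phi in [set~ 0]) (80 * (phi \in Bg)%:Z) = 80 * #|Bg|%:Z.
  rewrite -mulr_sumr; congr (_ * _).
  rewrite -sum1_card sum_intr [LHS]big_mkcond [RHS]big_mkcond /=.
  by apply: eq_bigr => phi _; rewrite !inE; case: (phi == 0) => //=; case: (leqP 10 _).
by move: St_ge St_le cB; rewrite S80; move: (\sum_(phi in _) _) #|Bg|; clear; lia.
Qed.

End FewNonzeros.

(** * From nonzeros to normalized zeros *)

Lemma card_nonzeros_ge R : R != 0 -> f R = 0 -> (34 <= #|U|)%N.
Proof.
move=> R0 fR; rewrite ltnNge; apply/negP => h; exact: (few_nonzeros_absurd h R0 fR).
Qed.

Lemma normalized_scale (v w : V) (c : F) :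
  normalized v -> normalized w -> v = c *: w -> v = w.
Proof.
case/existsP => i /andP[/eqP vi /forallP lti] /existsP[j /andP[/eqP wj /forallP ltj]] e.
have c0 : c != 0.
  by apply: contra_eq_neq vi => c0; rewrite e c0 scale0r mxE eq_sym oner_eq0.
suff c1 : c = 1 by rewrite e c1 scale1r.
case: (ltngtP i j) => [ij | ji | /val_inj ij].
- move: (ltj i) (congr1 (fun x : V => x 0 i) e).
  by rewrite ij /= mxE vi => /eqP ->; rewrite mulr0 => /eqP; rewrite oner_eq0.
- move: (lti j) (congr1 (fun x : V => x 0 j) e).
  rewrite ji /= mxE wj mulr1 => /eqP -> /esym c1.
  by rewrite c1 eqxx in c0.
move: (congr1 (fun x : V => x 0 i) e); rewrite mxE vi ij wj mulr1; exact: esym.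
Qed.

Lemma normalized_neq0 (v : V) : normalized v -> v != 0.
Proof.
case/existsP => i /andP[/eqP vi _]; apply/eqP => v0.
by move: vi; rewrite v0 mxE => /esym/eqP; rewrite oner_eq0.
Qed.

(** [Z] and [U] together represent distinct projective points, so their nonzero multiples inject
    into the 255 nonzero vectors. Hence #|Z| + #|U| <= 85, and 85 - 34 = 51. *)
Theorem card_normalized_zeros :
  (#|[set v : V | normalized v & f v == 0%R]| <= 51)%N.
Proof.
set Z := [set v : V | _].
have [-> | [R]] := set_0Vmem Z; first by rewrite cards0.
rewrite inE => /andP[nR /eqP fR].
have U34 := card_nonzeros_ge (normalized_neq0 nR) fR.
pose g (z : F * V) := z.1 *: z.2.
have dZU : [disjoint Z & U].
  rewrite disjoints_subset; apply/subsetP => v; rewrite !inE => /andP[_ /eqP ->].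
  by rewrite eq_sym oner_eq0.
have cX : #|setX [set~ 0%R : F] (Z :|: U)| = (3 * (#|Z| + #|U|))%N.
  by rewrite cardsX card_unitF cardsU (disjoint_setI0 dZU) cards0 subn0.
suff : (#|setX [set~ 0%R : F] (Z :|: U)| <= #|[set~ (0%R : V)]|)%N.
  rewrite cX cardsC1 card_mx card_F -[(4 ^ _).-1]/255%N.
  by move: U34; move: #|Z| #|U|; clear; lia.
have inj_g : {in setX [set~ 0] (Z :|: U) &, injective g}.
  move=> [c v] [c' w] /setXP[/= c0 hv] /setXP[/= c0' hw].
  rewrite /g /= => e; rewrite !inE in c0 c0' hv hw.
  have vw : v = (c^-1 * c') *: w by rewrite -scalerA -e scalerA mulVf // scale1r.
  have same : v = w.
    case/orP: hv => [/andP[nv /eqP fv] | /eqP fv]; case/orP: hw => [/andP[nw /eqP fw] | /eqP fw].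
    - exact: normalized_scale vw.
    - move: fv; rewrite vw fZ fw mulr1 => /eqP; rewrite mulf_eq0 invr_eq0.
      by rewrite (negPf c0) (negPf c0').
    - by move: fv; rewrite vw fZ fw mulr0 => /esym/eqP; rewrite oner_eq0.
    - by move: fv; rewrite vw fZ fw mulr1 => ->; rewrite scale1r.
  rewrite -same in e hw *; congr pair; apply/eqP; rewrite -subr_eq0.
  move/eqP: e; rewrite -subr_eq0 -scalerBl scaler_eq0 => /orP[-> // | /eqP v0].
  exfalso; case/orP: hv => [/andP[/normalized_neq0] | ]; first by rewrite v0 eqxx.
  by rewrite v0 -(scale0r (0 : V)) fZ mul0r eq_sym oner_eq0.
rewrite -(card_in_imset inj_g); apply/subset_leq_card/subsetP.
move=> _ /imsetP[[c v] /setXP[/= c0 hv] ->]; rewrite !inE scaler_eq0 in c0 *.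
rewrite (negPf c0) /=; move: hv; rewrite !inE => /orP[/andP[/normalized_neq0] // |].
by apply: contraTneq => ->; rewrite -(scale0r (0 : V)) fZ mul0r eq_sym oner_eq0.
Qed.

End QuarticFunction.

(** * Top coefficients of polynomials of bounded degree *)

Definition has_top (R : nzRingType) (m : nat) (P : {poly R}) (c : R) : Prop :=
  (size P <= m.+1)%N /\ P`_m = c.

Section HasTop.
Variable R : comNzRingType.
Implicit Types (P Q : {poly R}) (c d : R).

(** Stability under sums is the reason for letting the top coefficient be zero, unlike a leading
    coefficient. *)
Lemma has_top_sum (I : finType) m (P : I -> {poly R}) (c : I -> R) :
  (forall i, has_top m (P i) (c i)) -> has_top m (\sum_i P i) (\sum_i c i).
Proof.
move=> h; split; last by rewrite coef_sum; apply: eq_bigr => i _; case: (h i).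
by apply: (leq_trans (size_sum _ _ _)); apply/bigmax_leqP => i _; case: (h i).
Qed.

Lemma has_topM m n P Q c d :
  has_top m P c -> has_top n Q d -> has_top (m + n) (P * Q) (c * d).
Proof.
move=> [sP <-] [sQ <-]; split.
  by apply: leq_trans (size_polyMleq _ _) _; move: sP sQ; clear; lia.
have lm : (m < (m + n).+1)%N by rewrite ltnS leq_addr.
rewrite coefM (bigD1 (Ordinal lm)) //= addKn big1 ?addr0 // => j jm.
have [lt | lt | e] := ltngtP m j.
- by rewrite (nth_default _ (leq_trans sP lt)) mul0r.
- rewrite [Q`__]nth_default ?mulr0 //; apply: leq_trans sQ _.
  by move: lt; clear; lia.
- by case/eqP: jm; apply: val_inj.
Qed.

Lemma has_topX P c e : has_top 1 P c -> has_top e (P ^+ e) (c ^+ e).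
Proof.
move=> h; elim: e => [|e IHe]; last by rewrite !exprS -add1n; apply: has_topM.
by rewrite !expr0; split; rewrite ?size_poly1 // coef1.
Qed.

Lemma has_top_affine (a b : R) : has_top 1 (a%:P * 'X + b%:P) a.
Proof.
split; last by rewrite coefD coefMX coefC coefC addr0.
by rewrite size_MXaddC; case: ifP => // _; rewrite ltnS size_polyC leq_b1.
Qed.

Lemma has_topC c : has_top 0 c%:P c.
Proof. by split; rewrite ?coefC // size_polyC leq_b1. Qed.

Lemma has_top0 m : has_top m (0 : {poly R}) 0.
Proof. by split; rewrite ?coef0 // size_poly0. Qed.

End HasTop.

(** * Monomial expansion of a form and its restriction to lines *)

Definition mono4 (R : nzRingType) (x : 'rV[R]_4) (e0 e1 e2 e3 : nat) : R :=
  x 0 0 ^+ e0 * x 0 1%:R ^+ e1 * x 0 2%:R ^+ e2 * x 0 3%:R ^+ e3.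

(** Asking only [g 0 = 0] lets this apply at all four nested levels of [ev4]. *)
Lemma horner_map_wide (A : nzRingType) (R : comNzRingType) (g : A -> R) (q : {poly A}) y n :
  g 0 = 0 -> (size q <= n)%N ->
  (map_poly g q).[y] = \sum_(i < n) g q`_i * y ^+ i.
Proof.
move=> g0 sq; rewrite (@horner_coef_wide _ n); last exact: leq_trans (size_poly _ _) sq.
by apply: eq_bigr => i _; rewrite coef_map_id0.
Qed.

Section Expansion.
Variables (F : fieldType) (p : mpoly4 F) (d : nat).
Hypothesis hom_p : homogeneous d p.

Lemma coef4_eq0 e0 e1 e2 e3 : (e0 + e1 + e2 + e3)%N != d -> coef4 p e0 e1 e2 e3 = 0.
Proof. by move=> ne; apply: contraNeq ne => /hom_p/eqP. Qed.

Lemma ev4_expand (R : comNzRingType) (h : F -> R) (x : 'rV[R]_4) : h 0 = 0 ->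
  ev4 h p x = \sum_(e3 < d.+1) \sum_(e2 < d.+1) \sum_(e1 < d.+1) \sum_(e0 < d.+1)
    h (coef4 p e0 e1 e2 e3) * mono4 x e0 e1 e2 e3.
Proof.
move=> h0; have big e0 e1 e2 e3 : [|| d < e0, d < e1, d < e2 | d < e3]%N ->
    coef4 p e0 e1 e2 e3 = 0.
  by move=> lt; apply: coef4_eq0; move: lt; clear; lia.
have s3 : (size p <= d.+1)%N.
  apply/leq_sizeP => e3 lt; do 3!apply/polyP => ?; rewrite !coef0.
  by apply: big; rewrite lt !orbT.
have s2 e3 : (size (p`_e3)%R <= d.+1)%N.
  apply/leq_sizeP => e2 lt; do 2!apply/polyP => ?; rewrite !coef0.
  by apply: big; rewrite lt !orbT.
have s1 e3 e2 : (size (p`_e3`_e2)%R <= d.+1)%N.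
  apply/leq_sizeP => e1 lt; apply/polyP => ?; rewrite !coef0.
  by apply: big; rewrite lt !orbT.
have s0 e3 e2 e1 : (size (p`_e3`_e2`_e1)%R <= d.+1)%N.
  by apply/leq_sizeP => e0 lt; apply: big; rewrite lt.
rewrite /ev4 (horner_map_wide _ _ s3) ?map_poly0 // !horner_sum.
apply: eq_bigr => e3 _; rewrite !hornerM !horner_exp !hornerC.
rewrite (horner_map_wide _ _ (s2 _)) ?map_poly0 // !horner_sum !mulr_suml.
apply: eq_bigr => e2 _; rewrite !hornerM !horner_exp !hornerC.
rewrite (horner_map_wide _ _ (s1 _ _)) ?map_poly0 // !horner_sum !mulr_suml.
apply: eq_bigr => e1 _; rewrite !hornerM !horner_exp !hornerC.
rewrite (horner_map_wide _ _ (s0 _ _ _)) // !mulr_suml.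
by apply: eq_bigr => e0 _; rewrite /mono4 /coef4 !mulrA.
Qed.

Lemma ev4_scale c (v : 'rV[F]_4) : ev4 id p (c *: v) = c ^+ d * ev4 id p v.
Proof.
rewrite !ev4_expand // mulr_sumr; apply: eq_bigr => e3 _.
rewrite mulr_sumr; apply: eq_bigr => e2 _.
rewrite mulr_sumr; apply: eq_bigr => e1 _.
rewrite mulr_sumr; apply: eq_bigr => e0 _.
move: (e0 : nat) (e1 : nat) (e2 : nat) (e3 : nat) => {}e0 {}e1 {}e2 {}e3.
have [<- | /coef4_eq0 ->] := eqVneq (e0 + e1 + e2 + e3)%N d; last by rewrite !mul0r mulr0.
by rewrite /mono4 !mxE !exprMn !exprD; ring.
Qed.

(** The dehomogenized restriction sees the points [t *: a + b] as values, and the remaining point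
    [a], at infinity, as the coefficient of degree [d]. *)
Lemma ev4_line (a b : 'rV[F]_4) :
  let G := ev4 (fun c : F => c%:P) p (\row_i ((a 0 i)%:P * 'X + (b 0 i)%:P)) in
  has_top d G (ev4 id p a) /\ forall t, G.[t] = ev4 id p (t *: a + b).
Proof.
move=> G; rewrite /G ev4_expand ?polyC0 // ev4_expand //; split.
  apply: has_top_sum => e3; apply: has_top_sum => e2.
  apply: has_top_sum => e1; apply: has_top_sum => e0.
  move: (e0 : nat) (e1 : nat) (e2 : nat) (e3 : nat) => {}e0 {}e1 {}e2 {}e3.
  set c := coef4 _ _ _ _ _; have [c0 | c0] := eqVneq c 0.
    by rewrite c0 polyC0 !mul0r; apply: has_top0.
  rewrite /mono4 !mxE -(hom_p c0) -[X in has_top X]add0n -!addnA.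
  rewrite -!mulrA; apply: (has_topM (has_topC c)).
  have hX i e := has_topX e (has_top_affine (a 0 i) (b 0 i)).
  exact: has_topM (hX 0 e0) (has_topM (hX _ e1) (has_topM (hX _ e2) (hX _ e3))).
move=> t; rewrite ev4_expand // horner_sum; apply: eq_bigr => e3 _.
rewrite horner_sum; apply: eq_bigr => e2 _.
rewrite horner_sum; apply: eq_bigr => e1 _.
rewrite horner_sum; apply: eq_bigr => e0 _.
rewrite /mono4 !mxE !hornerM !horner_exp !hornerD !hornerM !hornerX !hornerC.
by rewrite ![t * _]mulrC.
Qed.

End Expansion.

(** Writing coordinates as linear forms lets [sum_prod_dot] treat monomials and extra linear factors
    together. *)
Lemma mono4_dot (F : fieldType) (v : 'rV[F]_4) e0 e1 e2 e3 :
  mono4 v e0 e1 e2 e3 =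
  \prod_(w <- nseq e0 (delta_mx 0 0) ++ nseq e1 (delta_mx 0 1%:R) ++
              nseq e2 (delta_mx 0 2%:R) ++ nseq e3 (delta_mx 0 3%:R)) dot v w.
Proof.
by rewrite !big_cat /= !big_nseq !dot_delta -!Monoid.iteropE /mono4 -!mulrA.
Qed.

Lemma sum_ev4_prod_dot (F : finFieldType) (p : mpoly4 F) d (s : seq 'rV[F]_4) :
  homogeneous d p -> (d + size s < 4 * #|F|.-1)%N ->
  \sum_v ev4 id p v * \prod_(w <- s) dot v w = 0.
Proof.
move=> hom_p lts.
under eq_bigr => v _ do rewrite (ev4_expand hom_p) // mulr_suml.
rewrite exchange_big big1 // => e3 _ /=; under eq_bigr => v _ do rewrite mulr_suml.
rewrite exchange_big big1 // => e2 _ /=; under eq_bigr => v _ do rewrite mulr_suml.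
rewrite exchange_big big1 // => e1 _ /=; under eq_bigr => v _ do rewrite mulr_suml.
rewrite exchange_big big1 // => e0 _ /=.
under eq_bigr => v _ do rewrite -mulrA mono4_dot -big_cat.
rewrite -mulr_sumr.
have [e | /(coef4_eq0 hom_p) ->] := eqVneq (e0 + e1 + e2 + e3)%N d; last by rewrite mul0r.
by rewrite sum_prod_dot ?mulr0 // !size_cat !size_nseq !addnA e.
Qed.

(** * Properties of a quartic form over F_4 *)

Section Surface.
Variable F : finFieldType.
Hypothesis card_F : #|F| = 4%N.
Variable p : mpoly4 F.
Hypothesis hom_p : homogeneous 4 p.
Local Notation V := 'rV[F]_4.
Let f (v : V) : F := ev4 id p v.

Lemma ev4_quartic_scale c (v : V) : f (c *: v) = c * f v.
Proof. by rewrite /f (ev4_scale hom_p) -[in c ^+ 4]card_F expf_card. Qed.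

(** The factor 1 - phi^3 is the indicator of the plane, and f L M (1 - phi^3) has degree at most 9,
    below 4 * 3 = 12, so its sum over all vectors vanishes. *)
Lemma ev4_quartic_orth (phi L M : V) :
  \sum_(u in sec [set u | f u == 1] phi) dot u L * dot u M = 0.
Proof.
have s1 : \sum_v f v * (dot v L * dot v M) = 0.
  rewrite -[RHS](@sum_ev4_prod_dot F p 4 [:: L; M]) ?card_F //.
  by apply: eq_bigr => v _; rewrite !big_cons big_nil mulr1.
have s2 : \sum_v f v * (dot v L * dot v M) * dot v phi ^+ 3 = 0.
  rewrite -[RHS](@sum_ev4_prod_dot F p 4 [:: L; M; phi; phi; phi]) ?card_F //.
  by apply: eq_bigr => v _; rewrite !big_cons big_nil /f; ring.
have : \sum_(v | (dot v phi == 0) && (f v != 0)) f v * (dot v L * dot v M) = 0.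
  transitivity (\sum_v f v * (dot v L * dot v M) -
    \sum_v f v * (dot v L * dot v M) * dot v phi ^+ 3); last by rewrite s1 s2 subrr.
  rewrite big_mkcond -sumrB; apply: eq_bigr => v _.
  have [v0 | v0] /= := eqVneq (dot v phi) 0.
    by rewrite v0 expr0n mulr0 subr0; case: eqP => //= ->; rewrite mul0r.
  by rewrite cube_eq1 // mulr1 subrr.
(* Nonzeros are grouped by their representative [u] in [U]. The multiple [c *: u] contributes c^3 =
   1 times the value at [u], and the three values of [c] add up to 3 = 1. *)
rewrite (partition_big (fun v => (f v)^-1 *: v) (mem (sec [set u | f u == 1] phi))) /=.
  move=> sum0; rewrite -[RHS]sum0; apply: eq_bigr => u; rewrite !inE => /andP[/eqP fu u0].
  rewrite (reindex_onto (fun c => c *: u) f) /=; last first.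
    by move=> v /andP[/andP[_ fv] /eqP <-]; rewrite scalerA mulfV // scale1r.
  rewrite (eq_bigl (fun c => c \in [set~ 0])); last first.
    move=> c; rewrite !inE ev4_quartic_scale fu mulr1 eqxx andbT dotZl (eqP u0) mulr0 eqxx /=.
    by case: eqP => //= /eqP c0; rewrite scalerA mulVf // scale1r eqxx.
  rewrite (eq_bigr (fun=> dot u L * dot u M)) ?sumr_const => [|c].
    by rewrite card_unitF // mulrSr -mulr_natr two_eq0 // mulr0 add0r.
  rewrite !inE ev4_quartic_scale fu mulr1 !dotZl => /(cube_eq1 card_F) c3.
  by transitivity (c ^+ 3 * (dot u L * dot u M)); [ring | rewrite c3 mul1r].
move=> v /andP[/eqP v0 fv].
by rewrite !inE ev4_quartic_scale mulVf // eqxx dotZl v0 mulr0 eqxx.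
Qed.

Hypothesis no_line : no_rational_line p.

(** If [f] vanished on the whole line, its restriction [G] would vanish at all four elements of [F].
    This alone does not kill a quartic, but the zero at [a] removes the coefficient of degree 4, so
    [G] is zero and the line lies on the surface. *)
Lemma ev4_quartic_line (phi psi : V) : phi != 0 -> psi \notin span1 phi ->
  exists v, [/\ dot v phi = 0, dot v psi = 0 & f v != 0].
Proof.
move=> p0 pp; set N := [set v : V | (dot v phi == 0) && (dot v psi == 0)].
have cN : #|N| = 16%N := card_perp2 card_F p0 (notin_span1 pp).
case: (boolP [exists v in N, f v != 0]) => [/exists_inP[v] | /exists_inPn f0].
  by rewrite inE => /andP[/eqP v1 /eqP v2] fv; exists v.
have large (A : {set V}) : (#|A| < 16)%N -> exists2 a, a \in N & a \notin A.
  rewrite -cN ltnNge => h; apply/subsetPn; apply: contra h; exact: subset_leq_card.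
have [a aN] : exists2 a, a \in N & a \notin [set 0] by apply: large; rewrite cards1.
rewrite inE => a0.
have [b bN ab] : exists2 b, b \in N & b \notin span1 a by apply: large; rewrite card_span1.
have f_ab c e : f (c *: a + e *: b) = 0.
  apply/eqP/negbNE/f0; move: aN bN; rewrite !inE !dotDl !dotZl.
  by move=> /andP[/eqP-> /eqP->] /andP[/eqP-> /eqP->]; rewrite !mulr0 addr0 eqxx.
case/negP: (no_line (rank_pair a0 (notin_span1 ab))); rewrite /contains_line.
have [[sG topG] evG] := ev4_line hom_p a b; set G := ev4 _ _ _ in sG topG evG *.
apply/eqP/(@roots_geq_poly_eq0 _ _ (enum F)); rewrite ?enum_uniq //.
  apply/allP => t _; rewrite /root evG.
  by have := f_ab t 1; rewrite scale1r /f => ->.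
rewrite -cardE card_F; move: sG; rewrite leq_eqVlt ltnS => /orP[/eqP sG | //].
have : lead_coef G = 0.
  by rewrite lead_coefE sG topG; have := f_ab 1 0; rewrite scale1r scale0r addr0.
by move/eqP; rewrite lead_coef_eq0 => /eqP ->; rewrite size_poly0.
Qed.

End Surface.

Theorem theorem2p3 (F : finFieldType) (card_F : #|F| = 4%N) (p : mpoly4 F) :
  homogeneous 4 p -> irreducible4 p -> no_rational_line p ->
  (npoints p <= 51)%N.
Proof.
move=> hom_p _ no_line; apply: card_normalized_zeros => //.
- exact: ev4_quartic_scale.
- exact: ev4_quartic_orth.
- exact: ev4_quartic_line.
Qed.
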